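(* Let $X,Y$ be finite metric spaces contained in a common ambient metric space $(Z,d)$ (with metrics restricted from $d$), with $Y\neq\varnothing$. For a nonempty finite subset $\sigma\subseteq X$ and $t>0$ define $$s_t(\sigma;Y)=\sum_{y\in Y}\exp\Bigl(-\frac1t\sum_{x\in\sigma}d(x,y)^2\Bigr),\qquad D(\sigma,y)=\sum_{x\in\sigma}d(x,y)^2,\qquad D^{*}(\sigma)=\min_{y\in Y}D(\sigma,y).$$ Then $$\lim_{t\to0^{+}}\bigl(-t\log s_t(\sigma;Y)\bigr)=D^{*}(\sigma).$$ Moreover, let $\epsilon\ge 0$ and let $R_\epsilon=\{(x,y)\in X\times Y: d(x,y)\le\epsilon\}$, with associated Dowker complex $\mathrm{D}_\epsilon(X,Y)$ and Dowker--Rips complex $\mathrm{DR}_\epsilon(X,Y)$. Then: (i) if $\sigma\in\mathrm{D}_\epsilon(X,Y)$, then $D^{*}(\sigma)\le \#\sigma\,\epsilon^2$, where $\#\sigma$ is the number of vertices of $\sigma$; (ii) if $\sigma\in\mathrm{DR}_\epsilon(X,Y)\setminus\mathrm{D}_\epsilon(X,Y)$, then $D^{*}(\sigma)>\epsilon^2$.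
   Context: For finite sets $X,Y$ and a relation $R\subseteq X\times Y$, the Dowker complex $\mathrm{D}_R(X,Y)$ is the simplicial complex with vertices in $X$ in which a nonempty finite subset $\sigma\subseteq X$ is a simplex if and only if there exists a common witness, i.e. some $y\in Y$ with $(x,y)\in R$ for all $x\in\sigma$. In the metric case one writes $\mathrm{D}_\epsilon(X,Y)=\mathrm{D}_{R_\epsilon}(X,Y)$. The flagification of a simplicial complex $K$ is the clique complex of its one-skeleton: $\mathrm{F}(K)=\mathrm{CliqueComplex}(K^{(1)})$, so its simplices are the vertices of $K$ together with all finite vertex sets every pair of which is an edge of $K$. The Dowker--Rips complex is $\mathrm{DR}_\epsilon(X,Y)=\mathrm{F}(\mathrm{D}_\epsilon(X,Y))$. Thus two distinct vertices $x_i,x_j$ span an edge of $\mathrm{DR}_\epsilon(X,Y)$ iff there is $y\in Y$ with $d(x_i,y)\le\epsilon$ and $d(x_j,y)\le\epsilon$, and a higher-dimensional simplex belongs to $\mathrm{DR}_\epsilon(X,Y)$ iff every pair of its vertices is an edge. *)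

(* Defs.v *)
From HB Require Import structures.
From mathcomp Require Import all_boot all_order all_algebra finmap.
From mathcomp Require Import all_classical all_reals all_analysis.

Set Implicit Arguments.
Unset Strict Implicit.
Unset Printing Implicit Defensive.

Import Order.TTheory GRing.Theory Num.Theory.
Import numFieldNormedType.Exports.

Local Open Scope classical_set_scope.
Local Open Scope ring_scope.

(* The vertices of [K] are the [v : V] with [faces K [fset v]]: an element of
   [V] need not be a vertex. *)
Record simplicial_complex (V : choiceType) := SimplicialComplex {
  faces :> set {fset V} ;
  faces_neq0 : forall s : {fset V}, faces s -> s != fset0 ;
  faces_down : forall s u : {fset V},
    faces s -> fsubset u s -> u != fset0 -> faces u }.

Section skeleton.
Variables (V : choiceType) (n : nat) (K : simplicial_complex V).

Definition skeleton_faces : set {fset V} :=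
  [set s | faces K s /\ (#|` s| <= n.+1)%N].

Fact skeleton_neq0 (s : {fset V}) : skeleton_faces s -> s != fset0.
Proof. by move=> [/faces_neq0]. Qed.

Fact skeleton_down (s u : {fset V}) :
  skeleton_faces s -> fsubset u s -> u != fset0 -> skeleton_faces u.
Proof.
move=> [Ks sn] us u0; split; first exact: faces_down Ks us u0.
exact: leq_trans (fsubset_leq_card us) sn.
Qed.

Definition skeleton := SimplicialComplex skeleton_neq0 skeleton_down.
End skeleton.

Section clique_complex.
Variables (V : choiceType) (G : simplicial_complex V).

(* Only the faces of [G] with one or two elements matter: [G] is read as a
   graph. *)
Definition clique_faces : set {fset V} :=
  [set s | [/\ s != fset0,
     forall x, x \in s -> faces G [fset x]%fset &
     forall x y, x \in s -> y \in s -> x != y ->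
       faces G [fset x; y]%fset]].

Fact clique_neq0 (s : {fset V}) : clique_faces s -> s != fset0.
Proof. by case. Qed.

Fact clique_down (s u : {fset V}) :
  clique_faces s -> fsubset u s -> u != fset0 -> clique_faces u.
Proof.
move=> [_ vs es] /fsubsetP us u0; split=> // [x xu|x y xu yu].
  exact/vs/us.
by apply: es; exact: us.
Qed.

Definition clique_complex := SimplicialComplex clique_neq0 clique_down.
End clique_complex.

Definition flagification (V : choiceType) (K : simplicial_complex V) :=
  clique_complex (skeleton 1 K).

Section dowker.
Variables (A B : choiceType) (X : {fset A}) (Y : {fset B}) (r : set (A * B)).

Definition dowker_faces : set {fset A} :=
  [set s | [/\ s != fset0, fsubset s X &
     exists2 y, y \in Y & forall x, x \in s -> r (x, y)]].

Fact dowker_neq0 (s : {fset A}) : dowker_faces s -> s != fset0.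
Proof. by case. Qed.

Fact dowker_down (s u : {fset A}) :
  dowker_faces s -> fsubset u s -> u != fset0 -> dowker_faces u.
Proof.
move=> [_ sX [y yY sy]] us u0; split=> //; first exact: fsubset_trans us sX.
by exists y => // x xu; apply: sy; exact: (fsubsetP us).
Qed.

Definition dowker_complex := SimplicialComplex dowker_neq0 dowker_down.
End dowker.

Section metric.
Variables (R : realType) (Z : metricType R).
Implicit Types (X Y s : {fset Z}) (y : Z) (e t : R).

Definition metric_rel X Y e : set (Z * Z) :=
  [set p | [/\ p.1 \in X, p.2 \in Y & mdist p.1 p.2 <= e]].

Definition metric_dowker X Y e : simplicial_complex Z :=
  dowker_complex X Y (metric_rel X Y e).

Definition dowker_rips X Y e : simplicial_complex Z :=
  flagification (metric_dowker X Y e).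

Definition sqdist_sum s y : R := \sum_(x <- s) mdist x y ^+ 2.

(* The minimum over [Y]; the head of the list of values only serves as the
   start of the iteration. The value is 0 when [Y] is empty. *)
Definition min_sqdist_sum s Y : R :=
  let vals := [seq sqdist_sum s y | y <- Y] in
  \big[Num.min/head 0 vals]_(v <- vals) v.

Fact min_sqdist_sum_le s Y y : y \in Y -> min_sqdist_sum s Y <= sqdist_sum s y.
Proof.
by move=> yY; rewrite /min_sqdist_sum big_map; exact: ge_bigmin_seq.
Qed.

Fact min_sqdist_sum_attained s Y : Y != fset0 ->
  exists2 y, y \in Y & min_sqdist_sum s Y = sqdist_sum s y.
Proof.
move=> Y0; suff : min_sqdist_sum s Y \in [seq sqdist_sum s y | y <- Y].
  by move=> /mapP[y yY ->]; exists y.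
have : [seq sqdist_sum s y | y <- Y] != [::].
  by apply: contra_neq Y0 => /(congr1 size); rewrite size_map => /cardfs0_eq.
rewrite /min_sqdist_sum /=; case: [seq _ | _ <- _] => // a l _.
rewrite big_seq; apply: (big_ind (fun v => v \in a :: l)) => //=.
  by rewrite inE eqxx.
by move=> u v ul vl; rewrite minEle; case: ifP.
Qed.

Definition exp_score t s Y : R :=
  \sum_(y <- Y) expR (- (1 / t * \sum_(x <- s) mdist x y ^+ 2)).

End metric.

(* Main.v *)
(** The score [s_t] is a sum of [#Y] exponentials, the largest of which is
    [exp (- D* / t)]. Hence [exp (- D* / t) <= s_t <= #Y exp (- D* / t)], and
    [- t log s_t] is squeezed between [D* - t log #Y] and [D*]. For (ii), a
    simplex with no common witness has, for every [y], a vertex at distance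
    more than [eps] from [y]. *)
Require Import Defs.
From mathcomp Require Import all_boot all_order all_algebra finmap.
From mathcomp Require Import all_classical all_reals all_analysis.
Import Order.TTheory GRing.Theory Num.Theory.
Import numFieldNormedType.Exports.
Local Open Scope classical_set_scope.
Local Open Scope ring_scope.

Lemma sumr_fset_le (R : numDomainType) (T : choiceType) (A : {fset T})
    (f : T -> R) (c : R) :
  (forall x, x \in A -> f x <= c) -> \sum_(x <- A) f x <= #|` A|%:R * c.
Proof.
move=> fc; rewrite [leRHS]mulr_natl -[in leRHS]count_predT -iter_addr_0.
by rewrite -big_const_seq big_seq [leRHS]big_seq; exact: ler_sum.
Qed.

Section exp_score_bounds.
Variables (R : realType) (Z : metricType R).
Implicit Types (s Y : {fset Z}) (t : R).

Lemma exp_scoreE t s Y :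
  exp_score t s Y = \sum_(y <- Y) expR (- (t^-1 * sqdist_sum s y)).
Proof. by apply: eq_bigr => y _; rewrite div1r. Qed.

(** The term of a minimiser [y] is the left-hand side; the other terms are nonnegative. *)
Lemma exp_score_ge t s Y : Y != fset0 ->
  expR (- (t^-1 * min_sqdist_sum s Y)) <= exp_score t s Y.
Proof.
move=> Y0; have [y yY ->] := min_sqdist_sum_attained s Y0.
rewrite exp_scoreE (big_fsetD1 y) //= lerDl.
by apply: sumr_ge0 => z _; exact: expR_ge0.
Qed.

Lemma exp_score_le t s Y : 0 < t ->
  exp_score t s Y <= #|` Y|%:R * expR (- (t^-1 * min_sqdist_sum s Y)).
Proof.
move=> t0; rewrite exp_scoreE; apply: sumr_fset_le => y yY.
by rewrite ler_expR lerN2 ler_pM2l ?invr_gt0 // min_sqdist_sum_le.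
Qed.

(** The factor [- t] reverses inequalities, so this upper bound comes from the lower bound
    [exp_score_ge]. *)
Lemma scaled_ln_exp_score_le t s Y : 0 < t -> Y != fset0 ->
  - t * ln (exp_score t s Y) <= min_sqdist_sum s Y.
Proof.
move=> t0 Y0; have ge := exp_score_ge t s Y Y0.
rewrite mulNr lerNl -ler_pdivrMl // mulrN -[leLHS]expRK ler_ln // posrE.
  exact: expR_gt0.
exact: lt_le_trans (expR_gt0 _) ge.
Qed.

Lemma scaled_ln_exp_score_ge t s Y : 0 < t -> Y != fset0 ->
  min_sqdist_sum s Y - t * ln #|` Y|%:R <= - t * ln (exp_score t s Y).
Proof.
move=> t0 Y0; have le := exp_score_le t s Y t0.
have N0 : 0 < #|` Y|%:R :> R by rewrite ltr0n cardfs_gt0.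
have S0 := lt_le_trans (expR_gt0 _) (exp_score_ge t s Y Y0).
have : ln (exp_score t s Y) <= ln #|` Y|%:R - t^-1 * min_sqdist_sum s Y.
  (* With the exponent written as [ln (expR _)], the right-hand side is the logarithm of the bound
     in [le]. *)
  rewrite -[X in _ <= _ + X]expRK.
  by rewrite -lnM ?posrE ?expR_gt0 // ler_ln ?posrE // mulr_gt0 ?expR_gt0.
rewrite -(ler_pM2l t0) mulrBr mulVKf ?gt_eqF // mulNr => h.
by rewrite -lerN2 opprK opprB.
Qed.

End exp_score_bounds.

Section dowker_bounds.
Variables (R : realType) (Z : metricType R) (X Y : {fset Z}) (eps : R).
Implicit Type s : {fset Z}.

Lemma min_sqdist_sum_dowker s : faces (metric_dowker X Y eps) s ->
  min_sqdist_sum s Y <= #|` s|%:R * eps ^+ 2.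
Proof.
move=> [_ _ [y yY sy]]; apply: le_trans (min_sqdist_sum_le s yY) _.
apply: sumr_fset_le => x /sy[_ _ /= dxy].
(* Squaring is monotone on nonnegative numbers; [eps] is one because it bounds a distance. *)
by rewrite lerXn2r ?nnegrE ?mdist_ge0 // (le_trans (mdist_ge0 _ _) dxy).
Qed.

(** Each vertex of a clique is a one-point face of the Dowker complex, hence lies in [X]. *)
Lemma dowker_rips_subset s : faces (dowker_rips X Y eps) s -> fsubset s X.
Proof.
move=> [_ vs _]; apply/fsubsetP => x /vs[[_ + _] _].
by rewrite fsub1set.
Qed.

Lemma min_sqdist_sum_not_dowker s : 0 <= eps -> Y != fset0 ->
  s != fset0 -> fsubset s X -> ~ faces (metric_dowker X Y eps) s ->
  eps ^+ 2 < min_sqdist_sum s Y.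
Proof.
move=> e0 Y0 s0 sX nDs; have [y yY ->] := min_sqdist_sum_attained s Y0.
have [x xs xy] : exists2 x, x \in s & eps < mdist x y.
  (* Otherwise the minimiser [y] would be a common witness for [s]. *)
  apply: contrapT => nx; apply: nDs; split=> //; exists y => // x xs.
  split=> //=; first exact: (fsubsetP sX).
  by rewrite leNgt; apply/negP => ?; apply: nx; exists x.
(* The summand at [x] alone exceeds [eps ^+ 2], and the others are squares. *)
rewrite /sqdist_sum (big_fsetD1 x) //=.
rewrite (lt_le_trans (y := mdist x y ^+ 2)) ?ltrXn2r ?nnegrE//.
by rewrite lerDl sumr_ge0 // => z _; rewrite sqr_ge0.
Qed.

End dowker_bounds.

Theorem proposition4p1 (R : realType) (Z : metricType R) (X Y : {fset Z})
    (Y_neq0 : Y != fset0) :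
  (forall s : {fset Z}, fsubset s X -> s != fset0 ->
     (- t * ln (exp_score t s Y)) @[t --> 0^'+] --> min_sqdist_sum s Y) /\
  (forall eps : R, 0 <= eps ->
     (forall s : {fset Z}, faces (metric_dowker X Y eps) s ->
        min_sqdist_sum s Y <= #|` s|%:R * eps ^+ 2) /\
     (forall s : {fset Z},
        (faces (dowker_rips X Y eps) `\` faces (metric_dowker X Y eps)) s ->
        eps ^+ 2 < min_sqdist_sum s Y)).
Proof.
split=> [s _ _|eps e0]; last first.
  split=> [s|s [DRs nDs]]; first exact: min_sqdist_sum_dowker.
  apply: (@min_sqdist_sum_not_dowker _ _ X) => //.
    exact: faces_neq0 DRs.
  exact: dowker_rips_subset DRs.
have lower : (min_sqdist_sum s Y - t * ln #|` Y|%:R) @[t --> 0^'+] -->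
    min_sqdist_sum s Y.
  rewrite -[X in _ --> X]subr0 -[X in _ --> _ - X](mul0r (ln #|` Y|%:R)).
  apply: cvgB; first exact: cvg_cst.
  apply: cvgMr_tmp; apply: cvg_at_right_filter; exact: cvg_id.
apply: (squeeze_cvgr _ lower (cvg_cst _)).
near=> t; have t0 : 0 < t by [].
by rewrite scaled_ln_exp_score_ge //= scaled_ln_exp_score_le.
Unshelve. all: by end_near.
Qed.
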